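(* Let $\Gamma$ be a graph not containing an embedded copy of the four-cycle $C_4$. Then the graph group $G(\Gamma)$ has no subgroup isomorphic to a direct product of two or more non-abelian groups, and $G(\Gamma)$ has no submonoid isomorphic to a direct product of two or more non-abelian (i.e. non-commutative) monoids.
   Context: A graph $\Gamma$ is a set $V(\Gamma)$ of vertices together with a reflexive, symmetric relation $E(\Gamma) \subseteq V(\Gamma) \times V(\Gamma)$; vertices $u,v$ are adjacent if $(u,v) \in E(\Gamma)$. An embedding of graphs is a map on vertices which is injective and preserves both adjacency and non-adjacency; so an embedded copy of $C_4$ in $\Gamma$ is an induced subgraph of $\Gamma$ isomorphic to $C_4$. The graph group $G(\Gamma)$ is the group with presentation $\langle V(\Gamma) \mid ab = ba \text{ for all } (a,b) \in E(\Gamma) \rangle$. $C_4$ is the four-cycle: four vertices $v_1, v_2, v_3, v_4$ where, among pairs of distinct vertices, exactly $\{v_1,v_2\}, \{v_2,v_3\}, \{v_3,v_4\}, \{v_4,v_1\}$ are adjacent. *)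

(* Defs.v *)
From HB Require Import structures.
From mathcomp Require Import all_boot.
From mathcomp Require Import boolp.

Set Implicit Arguments.
Unset Strict Implicit.
Unset Printing Implicit Defensive.

Local Open Scope group_scope.

Record graph := Graph {
  vertex :> Type;
  adj : vertex -> vertex -> Prop;
  adj_refl : forall u, adj u u;
  adj_sym : forall u v, adj u v -> adj v u
}.

Definition graph_embedding (D G : graph) (f : D -> G) : Prop :=
  injective f /\ (forall u v : D, adj u v <-> adj (f u) (f v)).

Definition embeds (D G : graph) : Prop :=
  exists f : D -> G, graph_embedding f.

(* [ordS] is the successor modulo 4. *)
Definition C4_adj (i j : 'I_4) : Prop := [|| i == j, ordS i == j | ordS j == i].

Lemma C4_adj_refl i : C4_adj i i.
Proof. by rewrite /C4_adj eqxx. Qed.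

Lemma C4_adj_sym i j : C4_adj i j -> C4_adj j i.
Proof. by rewrite /C4_adj (eq_sym j) [X in _ || X]orbC. Qed.

Definition C4 : graph := Graph C4_adj_refl C4_adj_sym.

(* The group < X | u = v for all (u, v) in R >. A letter (x, false) stands    *)
(* for the generator x, and (x, true) for its formal inverse.                 *)
Section Presentation.
Variable X : Type.

Definition word := seq ({classic X} * bool).

Variable R : word -> word -> Prop.

Inductive pres_eq : word -> word -> Prop :=
| PresRefl u : pres_eq u u
| PresSym u v : pres_eq u v -> pres_eq v u
| PresTrans u v w : pres_eq u v -> pres_eq v w -> pres_eq u w
| PresCat u u' v v' : pres_eq u u' -> pres_eq v v' -> pres_eq (u ++ v) (u' ++ v')
| PresCancel x b : pres_eq [:: (x, b); (x, ~~ b)] [::]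
| PresRel u v : R u v -> pres_eq u v.

Definition pres_rel : rel word := fun u v => `[< pres_eq u v >].

Lemma pres_rel_refl : reflexive pres_rel.
Proof. by move=> u; apply/asboolP; exact: PresRefl. Qed.

Lemma pres_rel_sym : symmetric pres_rel.
Proof. by move=> u v; apply/asboolP/asboolP; exact: PresSym. Qed.

Lemma pres_rel_trans : transitive pres_rel.
Proof.
by move=> v u w /asboolP uv /asboolP vw; apply/asboolP; exact: PresTrans uv vw.
Qed.

Canonical pres_equiv :=
  EquivRel pres_rel pres_rel_refl pres_rel_sym pres_rel_trans.

Local Open Scope quotient_scope.

Definition pres_group := {eq_quot pres_equiv}.

HB.instance Definition _ := Choice.on pres_group.
HB.instance Definition _ := EqQuotient.on pres_group.

Definition pres_pi (u : word) : pres_group := \pi u.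

Definition word_inv (u : word) : word := rev [seq (a.1, ~~ a.2) | a <- u].

Definition pres_mul (x y : pres_group) : pres_group :=
  pres_pi (repr x ++ repr y).
Definition pres_one : pres_group := pres_pi ([::] : word).
Definition pres_inv (x : pres_group) : pres_group :=
  pres_pi (word_inv (repr x)).

Lemma pres_piP (u v : word) :
  pres_pi u = pres_pi v <-> pres_eq u v.
Proof.
split=> [/eqmodP /asboolP // | uv].
by apply/eqmodP/asboolP.
Qed.

Lemma pres_piK (x : pres_group) : pres_pi (repr x) = x.
Proof. exact: reprK. Qed.

Lemma pres_reprK (u : word) : pres_eq (repr (pres_pi u)) u.
Proof. by apply/pres_piP; exact: pres_piK. Qed.

Lemma pres_piM (u v : word) :
  pres_mul (pres_pi u) (pres_pi v) = pres_pi (u ++ v).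
Proof. by apply/pres_piP/PresCat; exact: pres_reprK. Qed.

Lemma word_inv_cat u v : word_inv (u ++ v) = word_inv v ++ word_inv u.
Proof. by rewrite /word_inv map_cat rev_cat. Qed.

Lemma word_invK : involutive word_inv.
Proof.
move=> u; rewrite /word_inv map_rev revK -map_comp -[RHS]map_id.
by apply: eq_map => -[x b] /=; rewrite negbK.
Qed.

Lemma pres_eq_invr u : pres_eq (u ++ word_inv u) [::].
Proof.
elim: u => [|[x b] u IHu]; first exact: PresRefl.
rewrite -cat1s word_inv_cat -catA.
apply: (PresTrans (v := [:: (x, b)] ++ [::] ++ word_inv [:: (x, b)])).
  apply: PresCat; first exact: PresRefl.
  rewrite catA -[[::] ++ _]/(word_inv _) -[X in pres_eq _ X]cat0s.
  by apply: PresCat; [exact: IHu | exact: PresRefl].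
exact: PresCancel.
Qed.

Lemma pres_eq_invl u : pres_eq (word_inv u ++ u) [::].
Proof. by have := pres_eq_invr (word_inv u); rewrite word_invK. Qed.

Lemma pres_mulA : associative pres_mul.
Proof.
move=> x y z; rewrite -[x]pres_piK -[y]pres_piK -[z]pres_piK.
by rewrite !pres_piM catA.
Qed.

Lemma pres_mul1 : left_id pres_one pres_mul.
Proof. by move=> x; rewrite -[x in LHS]pres_piK pres_piM pres_piK. Qed.

Lemma pres_mulr1 : right_id pres_one pres_mul.
Proof. by move=> x; rewrite -[x in LHS]pres_piK pres_piM cats0 pres_piK. Qed.

Lemma pres_mulV : left_inverse pres_one pres_inv pres_mul.
Proof.
move=> x; rewrite -[x in X in pres_mul _ X]pres_piK pres_piM.
by apply/pres_piP; exact: pres_eq_invl.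
Qed.

Lemma pres_mulrV : right_inverse pres_one pres_inv pres_mul.
Proof.
move=> x; rewrite -[x in X in pres_mul X _]pres_piK pres_piM.
by apply/pres_piP; exact: pres_eq_invr.
Qed.

HB.instance Definition _ :=
  isGroup.Build pres_group pres_mulA pres_mul1 pres_mulr1 pres_mulV pres_mulrV.

End Presentation.

Inductive graph_group_rel (G : graph) : word G -> word G -> Prop :=
| GraphGroupRel (a b : G) : adj a b ->
    graph_group_rel [:: (a, false); (b, false)] [:: (b, false); (a, false)].

Definition graph_group (G : graph) : groupType := pres_group (@graph_group_rel G).

(* The index type [I] is arbitrary; elements of the product are all           *)
(* functions, with no finite-support condition.                               *)
Section DirectProductMonoid.
Variables (I : Type) (M : I -> monoidType).
Local Notation P := (forall i, M i).

Definition dprod_mul (x y : P) : P := fun i => x i * y i.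
Definition dprod_one : P := fun i => 1.

Lemma dprod_mulA : associative dprod_mul.
Proof. by move=> x y z; apply: functional_extensionality_dep => i; exact: mulgA. Qed.

Lemma dprod_mul1 : left_id dprod_one dprod_mul.
Proof. by move=> x; apply: functional_extensionality_dep => i; exact: mul1g. Qed.

Lemma dprod_mulr1 : right_id dprod_one dprod_mul.
Proof. by move=> x; apply: functional_extensionality_dep => i; exact: mulg1. Qed.

Definition dprod := P.

HB.instance Definition _ := Choice.on dprod.
HB.instance Definition _ :=
  isMonoid.Build dprod dprod_mulA dprod_mul1 dprod_mulr1.

End DirectProductMonoid.

Section DirectProductGroup.
Variables (I : Type) (H : I -> groupType).

Definition dprod_group := dprod H.

HB.instance Definition _ := Monoid.on dprod_group.

Definition dprod_inv (x : dprod_group) : dprod_group := fun i => (x i)^-1.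

Lemma dprod_mulV : left_inverse 1 dprod_inv *%g.
Proof. by move=> x; apply: functional_extensionality_dep => i; exact: mulVg. Qed.

Lemma dprod_mulrV : right_inverse 1 dprod_inv *%g.
Proof. by move=> x; apply: functional_extensionality_dep => i; exact: mulgV. Qed.

HB.instance Definition _ := hasInv.Build dprod_group dprod_inv.
HB.instance Definition _ :=
  Monoid_isGroup.Build dprod_group dprod_mulV dprod_mulrV.

End DirectProductGroup.

Definition noncommutative (M : magmaType) : Prop :=
  exists x y : M, ~ commute x y.

(* For groups, a bijection preserving products and 1 also preserves inverses. *)
Definition isomorphic (M N : baseUMagmaType) : Prop :=
  exists f : UMagmaMorphism.type M N, bijective f.

(* The operations of [S] are those of [G], restricted to [P]; as [P] is       *)
(* classically any subset, [S] ranges over all subgroups (submonoids) of [G]. *)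
Definition has_subgroup_iso (G K : groupType) : Prop :=
  exists (P : pred G) (S : subGroupType P), isomorphic S K.

Definition has_submonoid_iso (G K : monoidType) : Prop :=
  exists (P : pred G) (S : subMonoidType P), isomorphic S K.

(* Main.v *)
Require Import Defs.
From mathcomp Require Import all_boot.
From mathcomp Require Import boolp zify.

Set Implicit Arguments.
Unset Strict Implicit.
Unset Printing Implicit Defensive.

(** Write rho_v for the retraction of G = G(Gamma) killing the vertex v, and say
    that g avoids v when g is conjugate to a fixed point of rho_v.  A product of
    two non-commutative monoids inside G yields a, b, c, d such that a and b
    commute with c and d, while [a, b] and [c, d] are non-trivial.  A non-trivial
    commutator has two non-adjacent vertices that it does not avoid: otherwise it
    would be conjugate into the free abelian group of a clique, with all exponent
    sums zero.  So take such x, y for [c, d] and u, v for [a, b].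

    For a vertex x, the group G acts on the Bass-Serre tree of the HNN extension
    of the image of rho_x with stable letter x.  If g = [c, d] does not avoid x,
    then g fixes no vertex; a and b both map the ray towards the attracting end of
    g to a ray with the same end, so [a, b] fixes an edge of that ray, and
    therefore avoids every vertex that is equal to x or not adjacent to x.
    Applied to x and y, this shows that u and v are distinct from and adjacent to
    both x and y, and x, u, y, v span a four-cycle.

    This tree is embedded in the Cayley tree of a free group, whose vertices are
    reduced words and whose automorphisms are w |-> s * h(w) for a reduced word s
    and a permutation h of the letters. *)

(** * Automorphisms of the tree of reduced words *)

Section Tree.
Variable Y : eqType.
Implicit Types (l : Y * bool) (w s : seq (Y * bool)).

(* Words are stored with their last letter at the head, so that moving to a      *)
(* neighbouring vertex of the tree is a [push] on the stack.                      *)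
Definition inv_letter l := (l.1, ~~ l.2).

Definition push l w :=
  if w is l' :: w' then if l' == inv_letter l then w' else l :: w else [:: l].

Definition reduced w := sorted (fun l l' => l' != inv_letter l) w.

Definition map_letter (f : Y -> Y) l := (f l.1, l.2).

Lemma inv_letterK : involutive inv_letter.
Proof. by case=> y e; rewrite /inv_letter /= negbK. Qed.

Lemma map_letter_inv f l : map_letter f (inv_letter l) = inv_letter (map_letter f l).
Proof. by []. Qed.

Lemma map_letter_inj f : injective f -> injective (map_letter f).
Proof. by move=> fI [y e] [y' e'] [/fI -> ->]. Qed.

Lemma reduced_tail l w : reduced (l :: w) -> reduced w.
Proof. exact: path_sorted. Qed.

Lemma reduced_suffix s w : reduced (s ++ w) -> reduced w.
Proof. by elim: s => //= l s IHs /path_sorted. Qed.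

Lemma reduced_push l w : reduced w -> reduced (push l w).
Proof.
case: w => //= l' w w_red; case: (eqVneq l' (inv_letter l)) => [_|ll'] /=.
  exact: path_sorted w_red.
by rewrite ll'.
Qed.

Lemma push_cons l w : reduced (l :: w) -> push l w = l :: w.
Proof. by case: w => //= l' w /andP[/negbTE-> _]. Qed.

Lemma pushK l w : reduced w -> push l (push (inv_letter l) w) = w.
Proof.
case: w => [_|l' w] /=; first by rewrite eqxx.
rewrite inv_letterK; case: (eqVneq l' l) => [-> w_red | _ _] /=.
  exact: push_cons.
by rewrite eqxx.
Qed.

Lemma push_inj l l' w : push l w = push l' w -> l = l'.
Proof.
case: w => [[]|a w] //=; case: eqP => [a1|_]; case: eqP => [a2|_].
- by rewrite -[l]inv_letterK -[l']inv_letterK -a1 -a2.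
- by move/(congr1 size) => /=; lia.
- by move/(congr1 size) => /=; lia.
- by case.
Qed.

Lemma size_push_le l w : size (push l w) <= (size w).+1.
Proof. by case: w => //= l' w; case: ifP => //= _; lia. Qed.

Lemma size_foldr_push_le s w : size (foldr push w s) <= size s + size w.
Proof.
elim: s => //= l s IHs; apply: leq_trans (size_push_le _ _) _.
by rewrite addSn.
Qed.

Record tree_map (f : seq (Y * bool) -> seq (Y * bool)) (h : Y -> Y) : Prop :=
  TreeMap {
    tree_map_reduced : forall w, reduced w -> reduced (f w);
    tree_map_push : forall l w, reduced w ->
      f (push l w) = push (map_letter h l) (f w)
  }.

Lemma tree_map_cons f h l w : tree_map f h -> reduced (l :: w) ->
  f (l :: w) = push (map_letter h l) (f w).
Proof.
by move=> fh lw; rewrite -push_cons // (tree_map_push fh) // (reduced_tail lw).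
Qed.

Lemma tree_map_comp f f' h h' : tree_map f h -> tree_map f' h' ->
  tree_map (f \o f') (h \o h').
Proof.
move=> [f_red f_push] [f'_red f'_push]; split=> [w w_red | l w w_red] /=.
  by apply/f_red/f'_red.
by rewrite f'_push // f_push //; apply: f'_red.
Qed.

(** A tree map is determined by its effect on labels and by the image of the root, so identities
    between tree maps only have to be checked at the root. *)
Lemma eq_tree_map f f' h h' : tree_map f h -> tree_map f' h' -> h =1 h' ->
  f [::] = f' [::] -> forall w, reduced w -> f w = f' w.
Proof.
move=> fh f'h' eq_h eq_nil; elim=> // l w IHw lw.
rewrite (tree_map_cons fh lw) (tree_map_cons f'h' lw) IHw ?(reduced_tail lw) //.
by rewrite /map_letter eq_h.
Qed.

Lemma tree_map_id : tree_map id id.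
Proof. by split=> // -[y e] w. Qed.

Definition affine (s : seq (Y * bool)) (h : Y -> Y) w :=
  foldr push s (map (map_letter h) w).

Lemma affine_tree_map s h : reduced s -> tree_map (affine s h) h.
Proof.
move=> s_red.
have aff_red w : reduced (affine s h w).
  by elim: w => //= l w IHw; apply: reduced_push.
split=> // l [|l' w] //= w_red; case: eqP => // ->.
by rewrite /affine /= map_letter_inv pushK //; apply: aff_red.
Qed.

Definition shift l := affine [:: l] id.

Lemma shift_tree_map l : tree_map (shift l) id.
Proof. exact: affine_tree_map. Qed.

Lemma shiftK l w : reduced w -> shift l (shift (inv_letter l) w) = w.
Proof.
apply: (eq_tree_map (tree_map_comp (shift_tree_map _) (shift_tree_map _))
  tree_map_id) => //=.
by case: l => y e; rewrite /shift /affine /= /inv_letter /= negbK eqxx.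
Qed.

Lemma size_shift_rcons l w : size (shift (inv_letter l) (rcons w l)) <= size w.
Proof.
case: l => y e; rewrite /shift /affine map_rcons foldr_rcons /= eqxx.
by apply: leq_trans (size_foldr_push_le _ _) _; rewrite size_map addn0.
Qed.

Lemma reduced_map h w : injective h ->
  reduced w -> reduced (map (map_letter h) w).
Proof.
move=> h_inj; elim: w => //= l [|l' w] IHw //= /andP[ll' lw].
by rewrite -map_letter_inv (inj_eq (map_letter_inj h_inj)) ll'; apply: IHw.
Qed.

Lemma reduced_of_map h w : reduced (map (map_letter h) w) -> reduced w.
Proof.
elim: w => //= l [|l' w] IHw //= /andP[ll' lw]; apply/andP; split.
  by apply: contraNneq ll' => ->.
exact: IHw.
Qed.

Lemma reduced_overlap u v w :
  reduced (u ++ v) -> reduced (v ++ w) -> v != [::] -> reduced (u ++ v ++ w).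
Proof.
case: v => // l v; elim: u => // l' [|l'' u] IHu /=.
  by move=> /andP[-> _] ->.
by case/andP=> -> u_red ? ?; apply: IHu.
Qed.

Lemma tree_map_cat f h w : tree_map f h ->
  reduced (map (map_letter h) w ++ f [::]) ->
  f w = map (map_letter h) w ++ f [::].
Proof.
move=> fh; elim: w => //= l w IHw lw.
have w_red : reduced (l :: w).
  apply: (@reduced_of_map h).
  by case: (@cat_sorted2 _ _ (map (map_letter h) (l :: w)) _ lw).
by rewrite (tree_map_cons fh w_red) IHw ?(reduced_tail lw) ?push_cons.
Qed.

(** * The ray towards the attracting end of a translation *)

Section Ray.
Variables (g : seq (Y * bool) -> seq (Y * bool)) (h : Y -> Y).
Hypotheses (gh : tree_map g h) (h_inj : injective h).
Hypothesis g_moves : g [::] != [::].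
(** The path from the root to its image continues to the second image without backtracking: the root
    lies on the axis of [g]. *)
Hypothesis g_straight : reduced (map (map_letter h) (g [::]) ++ g [::]).

Let R n := iter n g [::].

Lemma iter_reduced n w : reduced w -> reduced (iter n g w).
Proof. by move=> ?; elim: n => //= n; apply: (tree_map_reduced gh). Qed.

Lemma iter_straight n : R n.+1 = map (map_letter (iter n h)) (g [::]) ++ R n.
Proof.
(* The first form comes from applying [g] to [R n], the second from extending the path to [R n]; the
   induction carries both, as each step uses both. *)
suff [] : R n.+1 = map (map_letter h) (R n) ++ g [::] /\
  R n.+1 = map (map_letter (iter n h)) (g [::]) ++ R n by [].
elim: n => [|n [IHh IHt]].
  split=> //; rewrite /R /= cats0 -[LHS]map_id; apply: eq_map => -[] //.
have map_iter : map (map_letter (iter n.+1 h)) (g [::]) =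
    map (map_letter (iter n h)) (map (map_letter h) (g [::])).
  by rewrite -map_comp; apply: eq_map => -[y e]; rewrite /map_letter /= -iterSr.
have eqR : map (map_letter h) (R n.+1) ++ g [::] =
    map (map_letter (iter n.+1 h)) (g [::]) ++ R n.+1.
  by rewrite IHt map_cat -catA -IHh IHt -map_comp.
rewrite -eqR; suff -> : R n.+2 = map (map_letter h) (R n.+1) ++ g [::] by [].
apply: (tree_map_cat gh); rewrite eqR IHt map_iter; apply: reduced_overlap.
- rewrite -map_cat; apply: reduced_map => //.
  by elim: (n) => //= k IHk; apply: inj_comp.
- by rewrite -IHt; apply: iter_reduced.
- by case: (g [::]) g_moves.
Qed.

Lemma size_iter n : size (R n) = n * size (g [::]).
Proof.
by elim: n => // n IHn; rewrite iter_straight size_cat size_map IHn mulSn.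
Qed.

Lemma suffix_iter m n : m <= n -> suffix (R m) (R n).
Proof.
move=> /subnK <-; elim: (n - m) => [|k IHk]; first exact: suffix_refl.
by rewrite addSn iter_straight; apply: suffix_catr.
Qed.

(** The head of a word is its last letter, so initial segments of a path from the root are
    suffixes. *)
Definition on_ray w := exists n, suffix w (R n).

Lemma on_ray_large w n0 : on_ray w -> exists2 n, n0 <= n & suffix w (R n).
Proof.
case=> n w_n; exists (maxn n0 n); first exact: leq_maxl.
exact: suffix_trans w_n (suffix_iter (leq_maxr _ _)).
Qed.

Lemma on_ray_reduced w : on_ray w -> reduced w.
Proof.
by case=> n /suffixP[s Es]; apply: (@reduced_suffix s); rewrite -Es; apply: iter_reduced.
Qed.

Lemma on_ray_suffix w w' : suffix w w' -> on_ray w' -> on_ray w.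
Proof. by move=> ww' [n w'n]; exists n; apply: suffix_trans w'n. Qed.

Lemma suffix_of_suffix w w' s :
  suffix w s -> suffix w' s -> size w <= size w' -> suffix w w'.
Proof.
rewrite !suffixE => /eqP Ew /eqP Ew' le_ww'.
have := congr1 size Ew; have := congr1 size Ew'; rewrite !size_drop => s1 s2.
have -> : drop (size w' - size w) w' =
    drop (size w' - size w) (drop (size s - size w') s) by rewrite Ew'.
rewrite drop_drop -[X in _ == X]Ew; apply/eqP; congr (drop _ s).
have w's : size w' <= size s by rewrite -s1 leq_subr.
by rewrite addnC addnBA // subnK.
Qed.

Lemma on_ray_eq w w' : on_ray w -> on_ray w' -> size w = size w' -> w = w'.
Proof.
move=> [n wn] w'_ray eq_size; have [n' le_nn' w'n'] := on_ray_large n w'_ray.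
have := suffix_of_suffix (suffix_trans wn (suffix_iter le_nn')) w'n'.
by rewrite eq_size leqnn suffixE eq_size subnn drop0 => /(_ isT) /eqP.
Qed.

Lemma on_ray_next w : on_ray w -> exists l, on_ray (l :: w).
Proof.
case=> n; case/suffixP=> s Es.
have : suffix w (R n.+1) by rewrite iter_straight Es catA suffix_suffix.
case/suffixP => t Et; case/lastP: t Et => [|t l] Et.
  have := congr1 size Et; rewrite iter_straight Es !size_cat size_map /=.
  by have := g_moves; case: (g [::]) => //= *; lia.
by exists l, n.+1; rewrite Et cat_rcons suffix_suffix.
Qed.

Lemma on_ray_size n : exists2 w, on_ray w & size w = n.
Proof.
elim: n => [|n [w /on_ray_next[l lw] <-]]; last by exists (l :: w).
by exists [::] => //; exists 0.
Qed.

(** Each push removes at most one letter of [w]. *)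
Lemma foldr_push_suffix s w : exists t, exists2 k, k <= size s &
  foldr push w s = t ++ drop k w.
Proof.
elim: s => [|l s [t [k ks /= ->]]]; first by exists [::], 0; rewrite ?drop0.
case: t => [|l' t] /=; last first.
  by case: ifP => _; [exists t | exists [:: l, l' & t]]; exists k => //; apply: leqW.
case E: (drop k w) => [|l' w'] /=.
  by exists [:: l], k; rewrite ?E //; apply: leqW.
case: ifP => _; last by exists [:: l], k; rewrite ?E //; apply: leqW.
exists [::], k.+1 => //=.
by rewrite -add1n -drop_drop E /= drop0.
Qed.

Lemma tree_map_foldr f f' w : tree_map f f' -> reduced w ->
  f w = foldr push (f [::]) (map (map_letter f') w).
Proof.
move=> ff'; elim: w => //= l w IHw lw.
by rewrite (tree_map_cons ff' lw) IHw ?(reduced_tail lw).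
Qed.

(** * Maps commuting with the translation preserve its end *)

Section Commuting.
Variables (a : seq (Y * bool) -> seq (Y * bool)) (ha : Y -> Y).
Hypotheses (aha : tree_map a ha) (ha_inj : injective ha).
Hypothesis ag : forall w, reduced w -> a (g w) = g (a w).

Lemma iter_commute n w : reduced w -> a (iter n g w) = iter n g (a w).
Proof.
by move=> w_red; elim: n => //= n <-; rewrite ag //; apply: iter_reduced.
Qed.

Lemma iter_tree_map n : tree_map (iter n g) (iter n h).
Proof.
elim: n => [|n IHn]; first exact: tree_map_id.
exact: (tree_map_comp gh IHn).
Qed.

Lemma iter_image_suffix n : exists t, exists2 k, k <= size (a [::]) &
  a (R n) = t ++ drop k (R n).
Proof.
have a0_red : reduced (a [::]) by exact: (tree_map_reduced aha).
rewrite /R iter_commute // (tree_map_foldr (iter_tree_map n)) //.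
by rewrite -(size_map (map_letter (iter n h))); apply: foldr_push_suffix.
Qed.

(* As [w] grows along the ray, [a w] moves along edges without backtracking: it  *)
(* may first shrink, by at most [size (a [::])], and then only grows.            *)
Lemma eventually_extends : exists2 w0, on_ray w0 & forall l w,
  on_ray (l :: w) -> size w0 <= size w -> a (l :: w) = map_letter ha l :: a w.
Proof.
(* Once one step extends the image, all later ones do: labels are mapped injectively, so consecutive
   letters of the image cannot cancel. *)
have step w0 l0 : on_ray (l0 :: w0) -> a (l0 :: w0) = map_letter ha l0 :: a w0 ->
    forall l w, on_ray (l :: w) -> size w0 <= size w ->
      a (l :: w) = map_letter ha l :: a w.
  move=> l0w0_ray l0w0_ext l w; move Ek: (size w - size w0) => k.
  elim: k => [|k IHk] in l w Ek *; move=> lw_ray le_w0w.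
    have [-> ->] // : l :: w = l0 :: w0.
    apply: on_ray_eq => //=; congr _.+1.
    by apply/eqP; rewrite eqn_leq le_w0w -subn_eq0 Ek.
  case: w Ek lw_ray le_w0w => [|l' w] /= Ek lw_ray le_w0w; first lia.
  have l'w_ray := on_ray_suffix (suffix_cons _ _) lw_ray.
  rewrite (tree_map_cons aha (on_ray_reduced lw_ray)) IHk //=; [|lia..].
  rewrite -map_letter_inv (inj_eq (map_letter_inj ha_inj)).
  by have /andP[/negbTE-> _] := on_ray_reduced lw_ray.
have [[w0 [l0 [l0w0 ext]]]|none] := pselect (exists w0 l0,
    on_ray (l0 :: w0) /\ a (l0 :: w0) = map_letter ha l0 :: a w0).
  exists w0; last exact: step ext.
  exact: on_ray_suffix (suffix_cons _ _) l0w0.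
(* If no step extended the image, each would shorten it by one letter, which is impossible beyond
   length [size (a [::])]. *)
have shrink w : on_ray w -> size (a w) + size w = size (a [::]).
  elim: w => [_|l w IHw lw]; first by rewrite addn0.
  rewrite -IHw; last exact: on_ray_suffix (suffix_cons _ _) lw.
  have := tree_map_cons aha (on_ray_reduced lw).
  case E: (a w) => [|l' w'] /=; first by move=> E'; case: none; exists w, l; rewrite E.
  case: ifP => _ E'; last by case: none; exists w, l; rewrite E.
  by rewrite E' addSnnS.
have [w /shrink Ew sw] := on_ray_size (size (a [::])).+1; lia.
Qed.

(* [a (iter n g [::]) = iter n g (a [::])] agrees with [iter n g [::]] except for *)
(* a bounded number of letters, so the image of the ray has the same end.         *)
Lemma ray_preserved : exists m m', forall w, on_ray w -> m <= size w ->
  on_ray (a w) /\ size (a w) + m = size w + m'.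
Proof.
have [w0 w0_ray ext] := eventually_extends.
have mono w t : on_ray (t ++ w) -> size w0 <= size w ->
    suffix (a w) (a (t ++ w)) /\ size (a (t ++ w)) = size (a w) + size t.
  elim: t => [|l t IHt] /= ltw w0w; first by rewrite suffix_refl addn0.
  have [sfx sz] := IHt (on_ray_suffix (suffix_cons _ _) ltw) w0w.
  rewrite (ext _ _ ltw) ?size_cat /=; last by rewrite (leq_trans w0w) // leq_addl.
  by rewrite sz addnS -cat1s suffix_catr.
(* The integer [m' - m] is the amount by which [a] shifts levels along the ray. *)
exists (size w0), (size (a w0)) => w w_ray w0w; split; last first.
  have [n le_n] := w_ray; have [n' le_nn' w0n'] := on_ray_large n w0_ray.
  have wn' := suffix_trans le_n (suffix_iter le_nn').
  have /suffixP[t Et] := suffix_of_suffix w0n' wn' w0w.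
  have [|//|_] := mono w0 t; rewrite -Et // => ->.
  by rewrite Et size_cat; lia.
(* With this [n], at least [size (a w)] letters of [R n] remain after up to [size (a [::])] are
   lost, so [a w] is a suffix of what remains. *)
have [n le_n wn] := on_ray_large (size (a [::]) + size (a w)) w_ray.
have [s Es] : exists s, R n = s ++ w by apply/suffixP.
have [] := mono w s; rewrite -?Es //; first by exists n; rewrite suffix_refl.
have [t [k ks ->]] := iter_image_suffix n => sfx _.
apply: (@on_ray_suffix _ (drop k (R n))); last by exists n; apply: suffix_drop.
apply: suffix_of_suffix sfx (suffix_suffix _ _) _.
rewrite size_drop size_iter.
have g_pos : 0 < size (g [::]) by rewrite lt0n size_eq0.
have := leq_pmulr n g_pos; lia.
Qed.

End Commuting.

End Ray.

(** Strong induction on the distance by which [g] moves the root. If the root is on the axis, [a]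
    and [b] shift the levels of the ray by constants, and such shifts commute; each level holds one
    vertex of the ray, so the two composites agree far enough out. *)
Lemma commute_on_edge (g a b : seq (Y * bool) -> seq (Y * bool)) h ha hb :
    tree_map g h -> tree_map a ha -> tree_map b hb ->
    injective h -> injective ha -> injective hb ->
    (forall w, reduced w -> a (g w) = g (a w)) ->
    (forall w, reduced w -> b (g w) = g (b w)) ->
    (forall w, reduced w -> g w <> w) ->
  exists l z, [/\ reduced z, a (b z) = b (a z) &
    a (b (push l z)) = b (a (push l z))].
Proof.
have [n] := ubnP (size (g [::])); elim: n => // n IHn in g a b *.
move=> g_le gh aha bhb h_inj ha_inj hb_inj ag bg g_free.
have g0_red : reduced (g [::]) by apply: (tree_map_reduced gh).
have g_moves : g [::] != [::] by apply/eqP/(g_free [::] isT).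
case: (boolP (reduced (map (map_letter h) (g [::]) ++ g [::]))) => straight.
  have [m1 [m1' ray_a]] := ray_preserved gh h_inj g_moves straight aha ha_inj ag.
  have [m2 [m2' ray_b]] := ray_preserved gh h_inj g_moves straight bhb hb_inj bg.
  (* Each map lowers levels by at most its threshold, so this bound keeps the intermediate images in
     range. *)
  have agree w : on_ray g w -> m1 + m2 + m1 + m2 <= size w -> a (b w) = b (a w).
    move=> w_ray w_large.
    have [||aw_ray aw_size] := ray_a w => //; first lia.
    have [||bw_ray bw_size] := ray_b w => //; first lia.
    have [||abw_ray abw_size] := ray_a (b w) => //; first lia.
    have [||baw_ray baw_size] := ray_b (a w) => //; first lia.
    apply: (on_ray_eq gh h_inj g_moves straight) => //; lia.
  have [w w_ray w_size] := on_ray_size gh h_inj g_moves straight (m1 + m2 + m1 + m2).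
  have [l lw_ray] := on_ray_next gh h_inj g_moves straight w_ray.
  have lw_red := on_ray_reduced gh lw_ray.
  exists l, w; split; first exact: reduced_tail lw_red.
    by apply: agree; rewrite ?w_size.
  by rewrite push_cons //; apply: agree => //=; rewrite w_size.
have [top [f [bot [gE gE' cancel]]]] : exists top f bot,
    [/\ g [::] = top :: f, last top f = bot & map_letter h bot = inv_letter top].
  case E: (g [::]) g_moves g0_red straight => [|top f] // _ f_red.
  exists top, f, (last top f); split=> //; apply/eqP.
  apply: contraNT straight => cancel.
  rewrite lastI map_rcons cat_rcons -lastI; apply: (@reduced_overlap _ [:: _]) => //.
    rewrite cats1 -map_rcons -lastI; exact: reduced_map.
  apply/andP; split; last exact: f_red.
  by apply: contraNneq cancel => topE; apply/eqP; rewrite [in RHS]topE inv_letterK.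
have [f' fE] : exists f', f = rcons f' bot.
  case/lastP: f gE gE' {straight} => [|f' l] gE; last first.
    by rewrite last_rcons => <-; exists f'.
  (* A one-letter displacement cannot cancel with its translate: relabelling keeps orientations, so
     [g] inverts no edge. *)
  by move=> /= topE; move: cancel; rewrite topE; case: (bot) => y e [_]; case: e.
(* If [g [::]] and its translate cancel, moving the base point one step along     *)
(* [g [::]] shortens the displacement by two.                                     *)
pose conj (f : seq (Y * bool) -> seq (Y * bool)) :=
  shift (inv_letter bot) \o (f \o shift bot).
have conj_map f0 f1 : tree_map f0 f1 -> tree_map (conj f0) f1.
  move=> f01; exact: (tree_map_comp (shift_tree_map _)
    (tree_map_comp f01 (shift_tree_map _))).
have shift_red l w : reduced w -> reduced (shift l w).
  exact: (tree_map_reduced (shift_tree_map l)).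
have conj_comp f0 f1 h0 w : tree_map f1 h0 -> reduced w ->
    conj f0 (conj f1 w) = shift (inv_letter bot) (f0 (f1 (shift bot w))).
  move=> f1h0 w_red; rewrite /conj /= shiftK //.
  by apply: (tree_map_reduced f1h0); apply: shift_red.
have conj_commute f0 f1 h0 h1 w : tree_map f0 h0 -> tree_map f1 h1 ->
    (forall w, reduced w -> f0 (f1 w) = f1 (f0 w)) -> reduced w ->
    conj f0 (conj f1 w) = conj f1 (conj f0 w).
  move=> f0h0 f1h1 f01 w_red.
  rewrite (conj_comp _ _ _ _ f1h1 w_red) (conj_comp _ _ _ _ f0h0 w_red) f01 //.
  exact: shift_red.
have [||||//|//|//||||l [z [z_red abz ablz]]] := IHn (conj g) (conj a) (conj b).
- rewrite /conj /= -[shift bot [::]]/(push bot [::]) (tree_map_push gh) // cancel gE /=.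
  rewrite inv_letterK eqxx fE; apply: leq_ltn_trans (size_shift_rcons _ _) _.
  by move: g_le; rewrite gE fE /= size_rcons => /ltnW.
- exact: conj_map.
- exact: conj_map.
- exact: conj_map.
- by move=> w; apply: (conj_commute _ _ _ _ _ aha gh ag).
- by move=> w; apply: (conj_commute _ _ _ _ _ bhb gh bg).
- move=> w w_red gw; apply: (g_free (shift bot w)); first exact: shift_red.
  rewrite -[RHS]/(shift bot w) -{2}gw /conj /= shiftK //.
  by apply: (tree_map_reduced gh); apply: shift_red.
have lz_red : reduced (push l z) by apply: reduced_push.
have unconj f0 f1 h0 h1 w : tree_map f0 h0 -> tree_map f1 h1 -> reduced w ->
    shift bot (conj f0 (conj f1 w)) = f0 (f1 (shift bot w)).
  move=> f0h0 f1h1 w_red; rewrite (conj_comp _ _ _ _ f1h1 w_red) shiftK //.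
  by apply: (tree_map_reduced f0h0); apply: (tree_map_reduced f1h1); apply: shift_red.
exists l, (shift bot z); split; first exact: shift_red.
  by rewrite -(unconj _ _ _ _ _ aha bhb) // -(unconj _ _ _ _ _ bhb aha) // abz.
have -> : push l (shift bot z) = shift bot (push l z).
  by rewrite (tree_map_push (shift_tree_map bot)) // /map_letter -surjective_pairing.
by rewrite -(unconj _ _ _ _ _ aha bhb) // -(unconj _ _ _ _ _ bhb aha) // ablz.
Qed.

End Tree.

Local Open Scope group_scope.

(** * Retractions and balanced words *)

Section GraphGroup.
Variable Gamma : graph.
Local Notation A := (graph_group Gamma).
Local Notation W := (word Gamma).
Implicit Types (v x u : {classic Gamma}) (a b g h k p : A) (w : W).

Definition elt w : A := pres_pi (@graph_group_rel Gamma) w.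

Lemma eltP a : exists w, a = elt w.
Proof. by exists (repr a); rewrite /elt pres_piK. Qed.

Lemma elt_cat w w' : elt (w ++ w') = elt w * elt w'.
Proof. by rewrite /elt -pres_piM. Qed.

Lemma elt_cons c w : elt (c :: w) = elt [:: c] * elt w.
Proof. by rewrite -cat1s elt_cat. Qed.

Lemma elt0 : elt [::] = 1.
Proof. by []. Qed.

Lemma elt_letterV v e : elt [:: (v, ~~ e)] = (elt [:: (v, e)])^-1.
Proof.
by apply/esym/mulg1_eq; rewrite -elt_cat; apply/pres_piP; apply: PresCancel.
Qed.

Lemma elt_commute (c d : {classic Gamma} * bool) : adj (c.1 : Gamma) d.1 ->
  commute (elt [:: c]) (elt [:: d]).
Proof.
have pos v v' : adj (v : Gamma) v' ->
    commute (elt [:: (v, false)]) (elt [:: (v', false)]).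
  by move=> vv'; rewrite /commute -!elt_cat; apply/pres_piP/PresRel; constructor.
case: c d => [v [|]] [v' [|]] /= vv';
  rewrite -?[true]/(~~ false) ?(elt_letterV _ false).
- exact/commuteV/commute_sym/commuteV/commute_sym/pos.
- exact/commute_sym/commuteV/commute_sym/pos.
- exact/commuteV/pos.
- exact: pos.
Qed.

Definition kill v w : W := [seq c <- w | c.1 != v].

Lemma kill_eq v w w' : pres_eq (@graph_group_rel Gamma) w w' ->
  pres_eq (@graph_group_rel Gamma) (kill v w) (kill v w').
Proof.
elim=> {w w'} [w|w w' _|w1 w2 w3 _ + _|w1 w2 w3 w4 _ + _|y e|_ _ [y z yz]].
- exact: PresRefl.
- exact: PresSym.
- exact: PresTrans.
- by rewrite /kill !filter_cat; apply: PresCat.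
- rewrite /kill /=; case: eqP => _ /=; first exact: PresRefl.
  exact: PresCancel.
- rewrite /kill /=; case: eqP => _ /=; case: eqP => _ /=; try exact: PresRefl.
  by apply: PresRel; constructor.
Qed.

Definition retract v a : A := elt (kill v (repr a)).

Lemma retract_elt v w : retract v (elt w) = elt (kill v w).
Proof. by apply/pres_piP/kill_eq/pres_reprK. Qed.

Lemma retractM v : {morph retract v : a b / a * b}.
Proof.
move=> a b; have [[w ->] [w' ->]] := (eltP a, eltP b).
by rewrite -elt_cat !retract_elt -elt_cat /kill filter_cat.
Qed.

Lemma retract1 v : retract v 1 = 1.
Proof. by rewrite -elt0 retract_elt. Qed.

Lemma retractV v : {morph retract v : a / a^-1}.
Proof. by move=> a; apply/esym/mulg1_eq; rewrite -retractM mulgV retract1. Qed.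

Lemma retractJ v : {morph retract v : a b / a ^ b}.
Proof. by move=> a b; rewrite !conjgE !retractM retractV. Qed.

Lemma retract_idem v a : retract v (retract v a) = retract v a.
Proof.
by have [w ->] := eltP a; rewrite !retract_elt /kill filter_id.
Qed.

Definition avoids v a := exists2 k, retract v k = k & exists p, a = k ^ p.

Lemma avoids_conj v a p : avoids v a -> avoids v (a ^ p).
Proof. by case=> k vk [q ->]; exists k => //; exists (q * p); rewrite conjgM. Qed.

Definition balanced w :=
  forall v, count_mem (v, false) w = count_mem (v, true) w.

Lemma balanced_eq w w' : pres_eq (@graph_group_rel Gamma) w w' ->
  balanced w -> balanced w'.
Proof.
move=> ww' w_bal v; have := w_bal v.
(* The exponent sum of [v] is invariant; the equality of differences is written with sums. *)
suff : count_mem (v, false) w + count_mem (v, true) w' =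
       count_mem (v, false) w' + count_mem (v, true) w by lia.
elim: ww' => {w w' w_bal} [//|w w' _|w1 w2 w3 _ + _|w1 w2 w3 w4 _ + _|y e|_ _ [y z _]].
- lia.
- lia.
- rewrite !count_cat; lia.
- case: e => /=; rewrite !xpair_eqE !andbT !andbF; lia.
- rewrite /= !xpair_eqE !andbT !andbF; lia.
Qed.

Lemma balanced_commutator a b w : [~ a, b] = elt w -> balanced w.
Proof.
have [[w1 ->] [w2 ->]] := (eltP a, eltP b).
have eltV w' : (elt w')^-1 = elt (word_inv w').
  by apply: mulg1_eq; rewrite -elt_cat; apply/pres_piP/pres_eq_invr.
rewrite /commg conjgE !eltV -(elt_cat w1) -(elt_cat (word_inv w2)) -elt_cat.
move=> /pres_piP /balanced_eq; apply=> v.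
have count_inv e w' : count_mem (v, e) (word_inv w') = count_mem (v, ~~ e) w'.
  rewrite /word_inv count_rev count_map; apply: eq_count => -[y e'] /=.
  by rewrite !xpair_eqE; case: e e' => -[].
rewrite !count_cat !count_inv /=; lia.
Qed.

Lemma balanced_kill v w : balanced w -> balanced (kill v w).
Proof.
move=> w_bal y; rewrite !count_filter.
have [->|yv] := eqVneq y v.
  rewrite !(@eq_count _ _ pred0) ?count_pred0 // => -[z e] /=;
    by rewrite /= xpair_eqE; case: eqP => _ //=; rewrite andbF.
have keep e : count (predI (pred1 (y, e)) (fun c => c.1 != v)) w = count_mem (y, e) w.
  apply: eq_count => -[z e'] /=; rewrite xpair_eqE.
  by have [->|_] := eqVneq z y; rewrite /= ?yv ?andbT.
by rewrite !keep.
Qed.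

(** By balance the inverse of the first letter occurs later; the letters in between commute with it,
    so the pair cancels. *)
Lemma balanced_clique w : balanced w ->
  (forall c d, c \in w -> d \in w -> adj (c.1 : Gamma) d.1) -> elt w = 1.
Proof.
have [n] := ubnP (size w); elim: n => // n IHn in w *.
case: w => [//|[v e] w]; rewrite ltnS => w_size w_bal w_adj.
have : (v, ~~ e) \in w.
  rewrite -has_pred1 has_count; have := w_bal v.
  by case: (e) => /=; rewrite !xpair_eqE !eqxx /=; lia.
move=> vw; case/splitPr: vw w_size w_bal w_adj => w1 w2 w_size w_bal w_adj.
have w1_comm : commute (elt w1) (elt [:: (v, e)]).
  have w1_adj c : c \in w1 -> adj (v : Gamma) c.1.
    by move=> cw; apply: (w_adj (v, e)); rewrite inE ?eqxx // mem_cat cw orbT.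
  elim: (w1) w1_adj => [|c w' IHw'] c_adj.
    by rewrite /commute elt0 mul1g mulg1.
  rewrite (elt_cons c); apply: commute_sym; apply: commuteM.
    by apply: elt_commute; apply: c_adj; rewrite mem_head.
  by apply/commute_sym/IHw' => d dw; apply: c_adj; rewrite inE dw orbT.
have -> : elt ((v, e) :: w1 ++ (v, ~~ e) :: w2) = elt (w1 ++ w2).
  rewrite elt_cons elt_cat (elt_cons (v, ~~ e)) elt_letterV mulgA -w1_comm -mulgA mulVKg.
  by rewrite -elt_cat.
apply: IHn.
- by move: w_size; rewrite /= !size_cat /=; lia.
- move=> y; have := w_bal y; rewrite /= !count_cat /=.
  by case: (e) => /=; rewrite !xpair_eqE; case: (v == y) => /=; lia.
have sub : {subset w1 ++ w2 <= (v, e) :: w1 ++ (v, ~~ e) :: w2}.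
  by move=> c; rewrite !(inE, mem_cat) => /orP[] ->; rewrite !orbT.
by move=> c d /sub cw /sub; apply: w_adj.
Qed.

(* A word of minimal length among those representing conjugates of [elt w] only   *)
(* uses letters that [elt w] does not avoid, since deleting an avoided letter     *)
(* still gives a conjugate.                                                       *)
Lemma balanced_support w : balanced w -> elt w <> 1 ->
  exists v v', [/\ ~ adj (v : Gamma) v', ~ avoids v (elt w) & ~ avoids v' (elt w)].
Proof.
have [n] := ubnP (size w); elim: n => // n IHn in w *.
rewrite ltnS => w_size w_bal w_neq1.
have [[c cw [k vk [p wE]]]|full] :=
    pselect (exists2 c, c \in w & avoids c.1 (elt w)).
  have killE : elt (kill c.1 w) = elt w ^ (p^-1 * retract c.1 p).
    by rewrite -retract_elt wE retractJ vk conjgM conjgK.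
  have [|||v [v' [vv' v_supp v'_supp]]] := IHn (kill c.1 w).
  - apply: leq_trans w_size; rewrite size_filter ltn_neqAle count_size andbT.
    by rewrite -all_count; apply/allPn; exists c => //=; rewrite eqxx.
  - exact: balanced_kill.
  - rewrite killE => /eqP; rewrite conjg_eq1 => /eqP; exact: w_neq1.
  - exists v, v'; split=> //.
      by move=> /(avoids_conj (p^-1 * retract c.1 p)); rewrite -killE.
    by move=> /(avoids_conj (p^-1 * retract c.1 p)); rewrite -killE.
apply: contrapT => none; apply: w_neq1; apply: balanced_clique => // c d cw dw.
apply: contrapT => cd; apply: none; exists c.1, d.1.
by split=> // H; apply: full; [exists c | exists d].
Qed.


(** * The action on the Bass-Serre tree *)

Section Action.
Variables x u : {classic Gamma}.
Hypothesis u_far : forall v, adj (v : Gamma) x -> v != x -> v != u.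

(* A letter is an edge class b C with b in B, the image of rho_x, and C the       *)
(* centralizer of x in B.  It is encoded by the conjugate b x b^-1, from which    *)
(* vertices can be read back as elements of G, and by b rho_u(b)^-1, whose        *)
(* stabilizer consists of conjugates of fixed points of rho_u.                    *)
Definition twist a (y : A * A) : A * A :=
  (y.1 ^ (retract x a)^-1, retract x a * y.2 * (retract u (retract x a))^-1).

Lemma twistM a b y : twist (a * b) y = twist a (twist b y).
Proof. by rewrite /twist /= !retractM !invgM conjgM !mulgA. Qed.

Lemma twist1 y : twist 1 y = y.
Proof. by case: y => y z; rewrite /twist !retract1 invg1 conjg1 mul1g mulg1. Qed.

Lemma twist_inj a : injective (twist a).
Proof.
by apply: (@can_inj _ _ _ (twist a^-1)) => y; rewrite -twistM mulVg twist1.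
Qed.

Definition base (e : bool) : (A * A) * bool := ((elt [:: (x, false)], 1), e).

(** The stable letter moves the root along the base edge; the other generators lie in the image of
    rho_x and fix the root. *)
Definition letter_act (c : {classic Gamma} * bool) :=
  affine (if c.1 == x then [:: base c.2] else [::]) (twist (elt [:: c])).

Definition word_act w s := foldr letter_act s w.

Definition act a := word_act (repr a).

Lemma letter_act_tree c : tree_map (letter_act c) (twist (elt [:: c])).
Proof. by apply: affine_tree_map; case: ifP. Qed.

Lemma word_act_tree w : tree_map (word_act w) (twist (elt w)).
Proof.
elim: w => [|c w IHw].
  split=> //= l s _; rewrite elt0 /map_letter twist1 -surjective_pairing //.
have [cw_red cw_push] := tree_map_comp (letter_act_tree c) IHw.
split=> // l s s_red; rewrite [LHS]cw_push //; congr push.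
by rewrite /map_letter (elt_cons c w) twistM.
Qed.

Lemma word_act_cat w w' s : word_act (w ++ w') s = word_act w (word_act w' s).
Proof. exact: foldr_cat. Qed.

Lemma word_act_nil_eq w w' : elt w = elt w' ->
  word_act w [::] = word_act w' [::] ->
  forall s, reduced s -> word_act w s = word_act w' s.
Proof.
move=> ww' nil; apply: (eq_tree_map (word_act_tree w) (word_act_tree w') _ nil) => y.
by rewrite ww'.
Qed.

Lemma retract_letter v y e :
  retract v (elt [:: (y, e)]) = if y == v then 1 else elt [:: (y, e)].
Proof. by rewrite retract_elt /kill /=; case: eqP. Qed.

Lemma letter_act_nil c :
  letter_act c [::] = if c.1 == x then [:: base c.2] else [::].
Proof. by rewrite /letter_act /affine /=; case: ifP. Qed.

Lemma letter_act_single c l : letter_act c [:: l] =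
  push (map_letter (twist (elt [:: c])) l) (letter_act c [::]).
Proof. by rewrite -(tree_map_push (letter_act_tree c)). Qed.

Lemma twist_x e y : twist (elt [:: (x, e)]) y = y.
Proof.
by case: y => y z; rewrite /twist retract_letter eqxx retract1 !invg1 conjg1 mul1g mulg1.
Qed.

(** The first component is fixed because [v] commutes with [x], the second because rho_u fixes [v],
    by [u_far]. *)
Lemma twist_base v : adj (v : Gamma) x -> v != x ->
  twist (elt [:: (v, false)]) (elt [:: (x, false)], 1) = (elt [:: (x, false)], 1).
Proof.
move=> vx v_neq_x; rewrite /twist !retract_letter (negbTE v_neq_x).
rewrite retract_letter (negbTE (u_far vx v_neq_x)) /= mulg1 mulgV; congr pair.
by apply/conjg_fixP/commgP/commuteV/commute_sym/elt_commute.
Qed.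

(** The two sides of a relation act alike on labels, so they are compared at the root. The essential
    case is a relation between [x] and a neighbour, which holds because the neighbour fixes the base
    edge. *)
Lemma word_act_eq w w' : pres_eq (@graph_group_rel Gamma) w w' ->
  forall s, reduced s -> word_act w s = word_act w' s.
Proof.
elim=> {w w'} [//|w w' _ IH|w1 w2 w3 _ IH12 _ IH23|w1 w2 w3 w4 _ IH12 _ IH34
  |y e|_ _ [y z yz]] s s_red.
- by rewrite IH.
- by rewrite IH12 // IH23.
- rewrite !word_act_cat IH34 // IH12 //.
  exact: (tree_map_reduced (word_act_tree w4)).
- apply: word_act_nil_eq => //; first by apply/pres_piP; apply: PresCancel.
  rewrite /= letter_act_nil /=; case: (eqVneq y x) => [->|yx].
    rewrite letter_act_single letter_act_nil eqxx /map_letter twist_x.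
    by rewrite /= /inv_letter /= negbK eqxx.
  by rewrite letter_act_nil /= (negbTE yx).
- apply: word_act_nil_eq => //; first by apply/pres_piP; apply: PresRel.
  rewrite /= !letter_act_nil /=.
  have [yx|yx] := eqVneq (y : {classic Gamma}) x;
    have [zx|zx] := eqVneq (z : {classic Gamma}) x.
  + by rewrite yx zx.
  + rewrite !letter_act_single !letter_act_nil /= yx eqxx (negbTE zx) /=.
    rewrite /map_letter twist_base // -?yx //; exact: adj_sym.
  + rewrite !letter_act_single !letter_act_nil /= zx eqxx (negbTE yx) /=.
    by rewrite /map_letter twist_base // -zx.
  + by rewrite !letter_act_nil (negbTE yx) (negbTE zx).
Qed.

Lemma act_elt w s : reduced s -> act (elt w) s = word_act w s.
Proof. by apply: word_act_eq; apply: pres_reprK. Qed.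

Lemma act_tree a : tree_map (act a) (twist a).
Proof.
have [w ->] := eltP a; have [w_red w_push] := word_act_tree w.
split=> [s s_red|l s s_red]; rewrite !act_elt ?reduced_push //; first exact: w_red.
exact: w_push.
Qed.

Lemma actM a b s : reduced s -> act (a * b) s = act a (act b s).
Proof.
move=> s_red; have [[w ->] [w' ->]] := (eltP a, eltP b).
rewrite -elt_cat !act_elt ?word_act_cat //.
exact: (tree_map_reduced (word_act_tree w')).
Qed.

Lemma act1 s : reduced s -> act 1 s = s.
Proof. by move=> s_red; rewrite -elt0 act_elt. Qed.

Definition letter_val (l : (A * A) * bool) := if l.2 then l.1.1^-1 else l.1.1.

(** Bass-Serre vertices are cosets of the image of rho_x; on the orbit of the root, this is the
    representative of the coset that rho_x kills. *)
Definition vertex_val (s : seq ((A * A) * bool)) :=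
  foldr (fun l g => g * letter_val l) 1 s.

Lemma vertex_val_push l s : vertex_val (push l s) = vertex_val s * letter_val l.
Proof.
case: s => //= l' s; case: eqP => // -> /=; rewrite -mulgA.
by case: l => y [] /=; rewrite /letter_val /= ?mulgV ?mulVg mulg1.
Qed.

Lemma vertex_val_affine s a s' : vertex_val (affine s (twist a) s') =
  vertex_val s * vertex_val s' ^ (retract x a)^-1.
Proof.
elim: s' => [|l s' IHs] /=; first by rewrite conj1g mulg1.
rewrite vertex_val_push IHs conjMg -mulgA; congr (_ * (_ * _)).
by case: l => y [] //=; rewrite /letter_val /twist /= conjVg.
Qed.

Lemma vertex_val_letter_act c s :
  vertex_val (letter_act c s) * retract x (elt [:: c]) = elt [:: c] * vertex_val s.
Proof.
case: c => v e; rewrite vertex_val_affine retract_letter /=.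
case: (eqVneq v x) => [->|_] /=.
  rewrite invg1 conjg1 mulg1 mul1g; congr (_ * _).
  by case: e; rewrite /letter_val //= -elt_letterV.
by rewrite mul1g conjgE invgK -!mulgA mulVg mulg1.
Qed.

Lemma vertex_val_act a s : reduced s ->
  vertex_val (act a s) * retract x a = a * vertex_val s.
Proof.
have [w ->] := eltP a => s_red; rewrite act_elt //.
elim: w => [|c w IHw] /=; first by rewrite elt0 retract1 mulg1 mul1g.
rewrite elt_cons retractM mulgA vertex_val_letter_act -mulgA IHw.
by rewrite mulgA.
Qed.

(** Used twice: an element that does not avoid [x] fixes no vertex, and a commutator fixing a vertex
    is conjugated into the image of rho_x. *)
Lemma fixed_vertex a s : reduced s -> act a s = s -> a = retract x a ^ (vertex_val s)^-1.
Proof.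
move=> s_red a_fix; rewrite conjgE invgK -[in RHS]a_fix.
rewrite mulgA vertex_val_act // a_fix mulgK //.
Qed.

Lemma avoids_commutator g a b : ~ avoids x g -> commute a g -> commute b g ->
  avoids u [~ a, b].
Proof.
move=> g_x ag bg.
have act_commute c : commute c g ->
    forall s, reduced s -> act c (act g s) = act g (act c s).
  by move=> cg s s_red; rewrite -!actM // cg.
have g_free s : reduced s -> act g s <> s.
  move=> s_red /(fixed_vertex s_red) gE; apply: g_x.
  by exists (retract x g); [exact: retract_idem | exists (vertex_val s)^-1].
have [l [z [z_red abz ablz]]] := commute_on_edge (act_tree g) (act_tree a)
  (act_tree b) (@twist_inj g) (@twist_inj a) (@twist_inj b) (act_commute a ag)
  (act_commute b bg) g_free.
have fix_comm s : reduced s -> act a (act b s) = act b (act a s) ->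
    act [~ a, b] s = s.
  move=> s_red abs; have -> : [~ a, b] = (b * a)^-1 * (a * b).
    by rewrite /commg conjgE invgM !mulgA.
  by rewrite actM // (actM a b) // abs -(actM b a) // -actM // mulVg act1.
have hz := fix_comm z z_red abz.
have hlz := fix_comm (push l z) (reduced_push l z_red) ablz.
have : twist [~ a, b] l.1 = l.1.
  move: hlz; rewrite (tree_map_push (act_tree _)) // hz => /push_inj lE.
  by rewrite -[in RHS]lE.
rewrite /twist; case: (l.1) => y y' [_ fix_y'].
(* Let r be the image of the commutator under rho_x. Fixing [z] makes the commutator conjugate to r,
   and fixing the label component [y'] gives r = y' rho_u(r) y'^-1. *)
exists (retract u (retract x [~ a, b])); first exact: retract_idem.
exists (y'^-1 * (vertex_val z)^-1); rewrite conjgM.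
rewrite [LHS](fixed_vertex z_red hz); congr (_ ^ _).
by rewrite conjgE invgK mulgA; apply: (canRL (mulgK y')); rewrite -[in RHS]fix_y' mulgVK.
Qed.

End Action.
End GraphGroup.

(** * From commuting pairs to induced four-cycles *)

Lemma C4_of_commuting (Gamma : graph) (a b c d : graph_group Gamma) :
    ~ commute a b -> ~ commute c d ->
    commute a c -> commute a d -> commute b c -> commute b d ->
  embeds C4 Gamma.
Proof.
move=> ab cd ac ad bc bd.
have supp (p q : graph_group Gamma) : ~ commute p q -> exists v v' : Gamma,
    [/\ ~ adj v v', ~ avoids v [~ p, q] & ~ avoids v' [~ p, q]].
  move=> pq; have [w wE] := eltP [~ p, q]; rewrite wE.
  apply: balanced_support; first exact: balanced_commutator wE.
  by rewrite -wE => /eqP/commgP.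
have comm_cd (p : graph_group Gamma) : commute p c -> commute p d -> commute p [~ c, d].
  move=> pc pd; rewrite /commg conjgE.
  by do !apply: commuteM => //; apply: commuteV.
have [x [y [xy x_supp y_supp]]] := supp c d cd.
have [u [v [uv u_supp v_supp]]] := supp a b ab.
(* If [t] were [z] or not adjacent to [z], then [avoids_commutator] would make [[~ a, b]] avoid
   [t]. *)
have link z t : ~ avoids z [~ c, d] -> ~ avoids t [~ a, b] -> adj t z /\ t <> z.
  move=> z_supp t_supp; apply: contrapT => t_far; apply: t_supp.
  apply: (@avoids_commutator _ z t _ [~ c, d]) => //; [|exact: comm_cd..].
  move=> s sz s_neq_z; apply: contra_not_neq t_far => sE.
  by rewrite -sE; split=> //; apply/eqP.
have [[ux u_neq_x] [uy u_neq_y]] := (link x u x_supp u_supp, link y u y_supp u_supp).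
have [[vx v_neq_x] [vy v_neq_y]] := (link x v x_supp v_supp, link y v y_supp v_supp).
have x_neq_y : x <> y by move=> xyE; apply: xy; rewrite xyE; apply: adj_refl.
have u_neq_v : u <> v by move=> uvE; apply: uv; rewrite uvE; apply: adj_refl.
have yx : ~ adj y x by move=> /adj_sym.
have vu : ~ adj v u by move=> /adj_sym.
(* The non-adjacent pairs [x], [y] and [u], [v] are the diagonals of the cycle. *)
exists (fun i : 'I_4 => nth x [:: x; u; y; v] i); split.
  move=> [[|[|[|[|i]]]] // ?] [[|[|[|[|j]]]] // ?] /= E; apply: val_inj => //=;
    by exfalso; eauto using nesym.
move=> [[|[|[|[|i]]]] // ?] [[|[|[|[|j]]]] // ?]; rewrite /= /C4_adj -!val_eqE /=;
  split=> // _; do [exact: adj_refl | assumption | apply: adj_sym; assumption].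
Qed.

(** Elements supported in distinct coordinates commute, so two factors supply the four elements for
    [C4_of_commuting]. Stated for injective multiplicative maps, it serves groups and monoids
    alike. *)
Lemma not_embeds_product (Gamma : graph) (I : Type) (M : I -> monoidType)
    (f : dprod M -> graph_group Gamma) :
  ~ embeds C4 Gamma -> injective f -> {morph f : x y / x * y} ->
  (forall i, noncommutative (M i)) -> forall i j : I, i = j.
Proof.
move=> noC4 f_inj fM nc i j; apply: contrapT => ij; apply: noC4.
pose at_ (k : {classic I}) (p : M k) : dprod M :=
  dfwith (fun k : {classic I} => 1 : M k) p.
have at_comm k (p q : M k) : commute (f (at_ k p)) (f (at_ k q)) -> commute p q.
  rewrite /commute -!fM => /f_inj /(congr1 (fun F : dprod M => F k)).
  by rewrite /mul /= /dprod_mul /at_ !dfwith_in.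
have at_indep (k1 k2 : {classic I}) (p : M k1) (q : M k2) : k1 != k2 ->
    commute (f (at_ k1 p)) (f (at_ k2 q)).
  move=> k12; rewrite /commute -!fM; congr f; apply: functional_extensionality_dep.
  suff coord (k : {classic I}) : at_ k1 p k * at_ k2 q k = at_ k2 q k * at_ k1 p k by [].
  rewrite /at_; have [->|k1k] := eqVneq k k1.
    by rewrite [dfwith _ q k1]dfwith_out 1?eq_sym // mulg1 mul1g.
  by rewrite [dfwith _ p k]dfwith_out 1?eq_sym // mulg1 mul1g.
have [[p [q pq]] [s [t st]]] := (nc i, nc j).
apply: (@C4_of_commuting _ (f (at_ i p)) (f (at_ i q)) (f (at_ j s)) (f (at_ j t))) => //.
- by move/at_comm.
- by move/at_comm.
- by apply: at_indep; apply/eqP.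
- by apply: at_indep; apply/eqP.
- by apply: at_indep; apply/eqP.
- by apply: at_indep; apply/eqP.
Qed.

Theorem corollary8 (Gamma : graph) (hC4 : ~ embeds C4 Gamma) :
  (forall (I : Type) (H : I -> groupType),
     (exists i j : I, i <> j) ->
     (forall i : I, noncommutative (H i)) ->
     ~ has_subgroup_iso (graph_group Gamma) (dprod_group H)) /\
  (forall (I : Type) (M : I -> monoidType),
     (exists i j : I, i <> j) ->
     (forall i : I, noncommutative (M i)) ->
     ~ has_submonoid_iso (graph_group Gamma) (dprod M)).
Proof.
(* The isomorphism goes from [S] to the product, so the embedding is its inverse followed by the
   inclusion of [S]. *)
split=> I M [i [j ij]] nc [P [S [f [f' fK f'K]]]]; apply: ij;
  apply: (@not_embeds_product Gamma I M (fun x => val (f' x))) => //.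
- by move=> x y /val_inj; apply: can_inj f'K _ _.
- by move=> x y; rewrite -valM -(can2_gmulfM fK f'K).
- by move=> x y /val_inj; apply: can_inj f'K _ _.
- by move=> x y; rewrite -valM -(can2_gmulfM fK f'K).
Qed.
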